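(* For every positive integer $m$, let $$g_m=\min_{A\in \mathcal{K}_m}\left\{ m^{-1}\sum_{n\in \mathbb{Z}_m}\delta_A(n)\right\},$$ where $\mathcal{K}_m$ is the set of subsets $A\subseteq \mathbb{Z}_m$ such that $\delta_A(n)\geq 1$ for all $n\in\mathbb{Z}_m$. Then $$\limsup_{m\rightarrow\infty}g_m\leq 2.$$
   Context: For a positive integer $m$, $\mathbb{Z}_m$ denotes the set of residue classes modulo $m$. For $A\subseteq\mathbb{Z}_m$ and $n\in\mathbb{Z}_m$, $\delta_A(n)$ denotes the number of ordered pairs $(x,y)$ with $x,y\in A$ and $n=x-y$ in $\mathbb{Z}_m$. *)

(* Defs.v *)
(* MathComp / MathComp-Analysis *)
From HB Require Import structures.
From mathcomp Require Import all_boot all_order all_algebra.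
From mathcomp Require Import reals.

Set Implicit Arguments.
Unset Strict Implicit.
Unset Printing Implicit Defensive.

Import Order.TTheory GRing.Theory Num.Theory.
Local Open Scope ring_scope.

(* For m > 0 this is 'I_m with addition modulo m. The notation 'Z_m is not used
   because 'Z_1 is Z/2Z. At m = 0 it is the one-element group, a junk value. *)
Notation residue m := 'I_(m.-1.+1).

Definition delta (m : nat) (A : {set residue m}) (n : residue m) : nat :=
  #|[set p : residue m * residue m |
      [&& p.1 \in A, p.2 \in A & n == p.1 - p.2]]|.

Definition diffBases (m : nat) : {set {set residue m}} :=
  [set A : {set residue m} | [forall n : residue m, (1 <= delta A n)%N]].

Definition meanDelta (R : realType) (m : nat) (A : {set residue m}) : R :=
  m%:R^-1 * \sum_(n : residue m) (delta A n)%:R.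

(* The default point [set: residue m] lies in diffBases m (setT_diffBases), so
   the minimum is attained over diffBases m (g_min). *)
Definition g (R : realType) (m : nat) : R :=
  meanDelta R [arg min_(A < [set: residue m] in diffBases m) meanDelta R A]%O.

Lemma setT_diffBases (m : nat) : [set: residue m] \in diffBases m.
Proof.
rewrite inE; apply/forallP => n; apply/card_gt0P.
by exists (n, 0); rewrite !inE /= subr0 eqxx.
Qed.

Lemma g_min (R : realType) (m : nat) :
  (exists2 A, A \in diffBases m & g R m = meanDelta R A) /\
  (forall A, A \in diffBases m -> g R m <= meanDelta R A).
Proof.
rewrite /g; case: arg_minP => [|A KA minA]; first exact: setT_diffBases.
by split=> //; exists A.
Qed.

(* Main.v *)
(* The set {0, ..., k-1} together with {k, 2k, ..., k^2} has at most 2k elements,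
   and its differences jk - i already cover 0, ..., k^2. In Z_m the differences
   are closed under negation, so k^2 >= m/2 suffices to cover everything; taking
   k close to sqrt (m/2) gives |A|^2 / m <= (2k)^2 / m -> 2. *)
Require Import Defs.
From mathcomp Require Import all_boot all_order all_algebra.
From mathcomp Require Import all_classical all_reals all_analysis.
From mathcomp Require Import zify lra.

Import Order.TTheory GRing.Theory Num.Theory.

Local Open Scope ring_scope.

(** Each ordered pair from [A] is counted by [delta] at exactly one residue, namely its
    difference. *)
Lemma meanDelta_card (R : realType) (m : nat) (A : {set residue m}) :
  meanDelta R A = (#|A| ^ 2)%:R / m%:R.
Proof.
rewrite /meanDelta mulrC -natr_sum; congr (_%:R / _).
rewrite -mulnn -cardsX.
rewrite -sum1_card (partition_big (fun p => p.1 - p.2) xpredT) //=.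
apply: eq_bigr => n _; rewrite /delta -sum1_card; apply: eq_bigl => p.
by rewrite !inE andbA [n == _]eq_sym.
Qed.

Lemma inZpD (n i j : nat) : inZp (i + j) = inZp i + inZp j :> 'I_n.+1.
Proof. by apply: val_inj; rewrite /= modnDm. Qed.

Definition ruler (m k : nat) : {set residue m} :=
  [set inZp (i : nat) | i : 'I_k] :|: [set inZp (j.+1 * k) | j : 'I_k].

Lemma card_ruler (m k : nat) : (#|ruler m k| <= 2 * k)%N.
Proof.
rewrite mul2n -addnn (leq_trans (leq_card_setU _ _)) //.
by apply: leq_add; rewrite (leq_trans (leq_imset_card _ _)) ?card_ord.
Qed.

Lemma ruler_diff (m k n : nat) : (0 < k)%N -> (n <= k ^ 2)%N ->
  exists x y, [/\ x \in ruler m k, y \in ruler m k & inZp n = x - y].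
Proof.
move=> k0 nk.
have low i : (i < k)%N -> inZp i \in ruler m k.
  by move=> ik; apply/setUP; left; apply/imsetP; exists (Ordinal ik).
case: n => [|n] in nk *.
  by exists (inZp 0), (inZp 0); rewrite !low // subrr; split=> //; apply: val_inj.
have jk : (n %/ k < k)%N by rewrite ltn_divLR // mulnn.
have rk := ltn_pmod n k0.
(* The target is now [n.+1]. With [n = q * k + r], one has [n.+1 = (q + 1) * k - (k - 1 - r)];
   dividing the predecessor keeps [q < k] even when the target is [k ^ 2]. *)
exists (inZp ((n %/ k).+1 * k)), (inZp (k.-1 - n %% k)); split.
- by apply/setUP; right; apply/imsetP; exists (Ordinal jk).
- by apply: low; lia.
- apply/eqP; rewrite eq_sym subr_eq -inZpD; apply/eqP; congr inZp.
  by rewrite mulSn {2}(divn_eq n k); lia.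
Qed.

Lemma ruler_diffBases (m k : nat) :
  (0 < m)%N -> (m <= 2 * k ^ 2)%N -> ruler m k \in diffBases m.
Proof.
case: m => [//|m] _ mk; rewrite inE; apply/forallP => n.
have k0 : (0 < k)%N by case: k mk.
suff [x [y [xA yA ->]]] : exists x y,
    [/\ x \in ruler m.+1 k, y \in ruler m.+1 k & n = x - y].
  by apply/card_gt0P; exists (x, y); rewrite inE; apply/and3P.
have [nk|kn] := leqP n (k ^ 2).
  by have := @ruler_diff m.+1 k n k0 nk; rewrite valZpK.
have ltnm := ltn_ord n; rewrite /= in ltnm.
(* Here [m.+1 - n] represents [-n], so swapping the two elements of its representation yields
   [n]. *)
have nk' : (m.+1 - n <= k ^ 2)%N by lia.
have [x [y [xA yA xy]]] := @ruler_diff m.+1 k _ k0 nk'.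
exists y, x; split=> //; rewrite -opprB -xy; apply/eqP.
rewrite -addr_eq0 -[X in X + _]valZpK -inZpD subnKC; last exact: ltnW.
by apply/eqP/val_inj; rewrite /= modnn.
Qed.

Lemma half_sqrt (m : nat) : (0 < m)%N ->
  exists k, (2 * k ^ 2 <= m <= 2 * k.+1 ^ 2)%N.
Proof.
move=> m0; have exk : exists k, (m <= 2 * k ^ 2)%N by exists m; nia.
(* The witness is the predecessor of the least [k] with [m <= 2 * k ^ 2]; minimality gives the lower
   bound. *)
case: (ex_minnP exk) => -[|k] mk mink; first by lia.
exists k; rewrite mk andbT leqNgt; apply/negP => /ltnW /mink.
by rewrite ltnn.
Qed.

Lemma g_le (R : realType) (e : R) : 0 < e ->
  exists N, forall m, (N <= m)%N -> g R m <= 2 + e.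
Proof.
(* The ruler for [k.+1] requires [4 * (k + 1) ^ 2 <= (2 + e) * m]. Since [2 * k ^ 2 <= m], it
   suffices that [8 * k + 4 <= 2 * e * k ^ 2], and for [1 <= k] this follows from [6 <= e * k]. *)
move=> e0; pose K := (Num.bound (6 / e)).+1.
have eK : 6 <= e * K%:R.
  rewrite mulrC -ler_pdivrMr // ltW //.
  rewrite (lt_le_trans (archi_boundP _)) ?ler_nat //.
  by rewrite divr_ge0 // ltW.
exists (2 * K.+1 ^ 2)%N => m mN.
have m0 : (0 < m)%N by lia.
have [k /andP[km mk]] := half_sqrt _ m0.
(* Compare [2 * K.+1 ^ 2 <= m] with [m <= 2 * k.+1 ^ 2]. *)
have Kk : (K <= k)%N by nia.
have kA := card_ruler m k.+1.
have mA := proj2 (g_min R m) _ (ruler_diffBases _ _ m0 mk).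
apply: le_trans mA _; rewrite meanDelta_card ler_pdivrMr ?ltr0n //.
apply: (@le_trans _ _ ((2 * k.+1) ^ 2)%:R).
  by rewrite ler_nat leq_sqr.
have : (2 * k ^ 2)%:R <= m%:R :> R by rewrite ler_nat.
have : K%:R <= k%:R :> R by rewrite ler_nat.
have : 1 <= k%:R :> R by rewrite ler1n; lia.
rewrite !(natrX, natrM) -natr1.
set k' := k%:R; set m' := m%:R => k1 Kk' km'.
have ek : 6 <= e * k' by apply: le_trans eK _; rewrite ler_pM2l.
have : 6 * k' <= e * k' * k' by apply: ler_wpM2r; lra.
nra.
Qed.

Theorem theorem2 (R : realType) :
  (limn_esup (fun m : nat => (g R m)%:E) <= 2%:E)%E.
Proof.
apply/lee_addgt0Pr => e e0; have [N gN] := g_le _ _ e0.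
(* The upper limit is an infimum of suprema over neighbourhoods of infinity, so the single tail from
   [N] on bounds it. *)
rewrite /limn_esup /limf_esup; apply: ge_ereal_inf.
eexists; first by exists [set m | (N <= m)%N]%classic => //; exists N.
by apply: ge_ereal_sup => _ [m Nm <-]; rewrite -EFinD lee_fin gN.
Qed.
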